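(* Let $n$ and $k$ be integers with $n\ge 4$, $n\le 2k$ and $k+1<n$. Then the sequence $\{HL^j(CL(k,k,n-k-1))\}_{j\ge 0}$, taken with $H\cong P_n$, diverges by order.
   Context: All graphs are finite, simple and undirected. $P_n$ is the path on $n$ vertices. Fix $H\cong P_n$. Two edges of a graph $G$ are $P_n$-adjacent if they are distinct, share an endpoint, and both lie in a common subgraph of $G$ isomorphic to $P_n$. The graph $HL(G)$ has vertex set $E(G)$, with two vertices adjacent iff the corresponding edges are $P_n$-adjacent in $G$ (if $G$ has no edges, $HL(G)$ is the graph with no vertices). Set $HL^0(G)=G$ and $HL^{j+1}(G)=HL(HL^j(G))$. The sequence of $G$ diverges by order if for every positive integer $N$ there is an integer $j$ with $|V(HL^j(G))|\ge N$. For positive integers $x,y,z$, $CL(x,y,z)$ is the graph of order $x+y+z+1$ consisting of three vertex-disjoint paths of orders (numbers of vertices) $x,y,z$ together with one further vertex that is adjacent to exactly one end vertex of each of the three paths (for a path of order 1, its only vertex). For example $CL(1,1,1)=K_{1,3}$. *)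

(* Defs.v *)
From HB Require Import structures.
From mathcomp Require Import all_boot.

Set Implicit Arguments.
Unset Strict Implicit.
Unset Printing Implicit Defensive.

(* Finite simple undirected graphs; the vertex set may be empty. *)
Record sgraph := SGraph {
  vertex :> finType;
  adj : rel vertex;
  adj_sym : symmetric adj;
  adj_irrefl : irreflexive adj
}.

Definition edges (G : sgraph) : {set {set G}} :=
  [set [set p.1; p.2] | p : G * G & adj p.1 p.2].

Definition isomorphic (G H : sgraph) : bool :=
  [exists f : {ffun G -> H},
    [&& injectiveb f, [forall y, y \in codom f]
      & [forall x, forall y, adj (f x) (f y) == adj x y]]].

Definition is_subgraph (G : sgraph) (S : {set G}) (F : {set {set G}}) : bool :=
  (F \subset edges G) && [forall e in F, e \subset S].

Section Subgraph.
Variables (G : sgraph) (S : {set G}) (F : {set {set G}}).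

(* The disequality is implied by membership in F when is_subgraph S F holds;
   it makes the relation irreflexive for arbitrary F. *)
Definition subgraph_adj : rel {x : G | x \in S} :=
  fun x y => (val x != val y) && ([set val x; val y] \in F).

Fact subgraph_adj_sym : symmetric subgraph_adj.
Proof. by move=> x y; rewrite /subgraph_adj /= eq_sym setUC. Qed.

Fact subgraph_adj_irrefl : irreflexive subgraph_adj.
Proof. by move=> x; rewrite /subgraph_adj /= eqxx. Qed.

Definition subgraph : sgraph := SGraph subgraph_adj_sym subgraph_adj_irrefl.
End Subgraph.

Definition consecutive (i j : nat) : bool := (i.+1 == j) || (j.+1 == i).

Lemma consecutiveC i j : consecutive i j = consecutive j i.
Proof. by rewrite /consecutive orbC. Qed.

Lemma consecutivenn i : consecutive i i = false.
Proof. by rewrite /consecutive orbb -addn1 -{2}[i]addn0 eqn_add2l. Qed.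

Section PathGraph.
Variable n : nat.

Definition path_adj : rel 'I_n := fun i j => consecutive i j.

Fact path_adj_sym : symmetric path_adj.
Proof. by move=> i j; exact: consecutiveC. Qed.

Fact path_adj_irrefl : irreflexive path_adj.
Proof. by move=> i; exact: consecutivenn. Qed.

Definition path_graph : sgraph := SGraph path_adj_sym path_adj_irrefl.
End PathGraph.

Definition H_adjacent (H G : sgraph) (e f : {set G}) : bool :=
  [&& e != f, e :&: f != set0
    & [exists S : {set G}, exists F : {set {set G}},
        [&& is_subgraph S F, isomorphic (subgraph S F) H, e \in F & f \in F]]].

Section HLineGraph.
Variables H G : sgraph.

Definition HL_adj : rel {e : {set G} | e \in edges G} :=
  fun e f => H_adjacent H (val e) (val f).

Fact HL_adj_sym : symmetric HL_adj.
Proof.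
move=> e f; rewrite /HL_adj /= /H_adjacent eq_sym setIC; congr [&& _, _ & _].
by apply: eq_existsb => S; apply: eq_existsb => F; rewrite [(val e \in F) && _]andbC.
Qed.

Fact HL_adj_irrefl : irreflexive HL_adj.
Proof. by move=> e; rewrite /HL_adj /= /H_adjacent eqxx. Qed.

Definition HL : sgraph := SGraph HL_adj_sym HL_adj_irrefl.
End HLineGraph.

Definition HL_iter (H : sgraph) (j : nat) (G : sgraph) : sgraph := iter j (HL H) G.

Definition diverges_by_order (H G : sgraph) : Prop :=
  forall N : nat, 0 < N -> exists j : nat, N <= #|HL_iter H j G|.

Section CL.
Variables x y z : nat.

(* None is the further vertex; each of the three paths is attached to it at
   the end vertex of index 0. *)
Definition CL_vertex : finType := option ('I_x + 'I_y + 'I_z).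

Definition CL_adj : rel CL_vertex := fun u v =>
  match u, v with
  | Some (inl (inl i)), Some (inl (inl j)) => consecutive i j
  | Some (inl (inr i)), Some (inl (inr j)) => consecutive i j
  | Some (inr i), Some (inr j) => consecutive i j
  | None, Some (inl (inl i)) | Some (inl (inl i)), None => i == 0 :> nat
  | None, Some (inl (inr i)) | Some (inl (inr i)), None => i == 0 :> nat
  | None, Some (inr i) | Some (inr i), None => i == 0 :> nat
  | _, _ => false
  end.

Fact CL_adj_sym : symmetric CL_adj.
Proof. by move=> [[[i|i]|i]|] [[[j|j]|j]|] //=; exact: consecutiveC. Qed.

Fact CL_adj_irrefl : irreflexive CL_adj.
Proof. by move=> [[[i|i]|i]|] //=; exact: consecutivenn. Qed.

Definition CL : sgraph := SGraph CL_adj_sym CL_adj_irrefl.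

Lemma card_CL : #|CL| = x + y + z + 1.
Proof. by rewrite card_option !card_sum !card_ord addn1. Qed.
End CL.

(* Main.v *)
Require Import Defs.
From mathcomp Require Import all_boot.
From mathcomp Require Import zify.

(** Only subgraphs matter, since HL is monotone for them. The spider CL(k,k,m)
    with m = n-k-1 has a triangle with tails of k-1, k-1 and m-1 further vertices
    in its HL. If a cycle carries a tail at v, then the first tail edge, being
    incident with both cycle edges at v, can be inserted between them: in HL the
    cycle becomes one longer, the tail one shorter, and the two cycle edges at v
    are joined by a chord. All the adjacencies needed come from paths "tail, part
    of the cycle, tail": as long as three tails remain, going from one root to the
    next but one covers at least n vertices, because the arc left out has grown by
    exactly one vertex at each step; once the third tail is used up, one tail
    together with the whole cycle suffices. When all tails are absorbed there is a
    cycle with a chord and at least n vertices; inserting the chord in the cycle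
    in the same way gives a cycle with a chord that is longer by one, forever. *)

(** * Copies of P_n and adjacency of edges *)

(** Paths are given by enumerating their vertices, that is, by maps out of [H]; the isomorphism
    wanted is the inverse of such an enumeration. *)
Lemma isomorphic_bij (G H : sgraph) (h : H -> G) :
  injective h -> (forall x, exists i, h i = x) ->
  (forall i j, adj (h i) (h j) = adj i j) -> isomorphic G H.
Proof.
move=> h_inj h_surj h_adj.
have h_surjb x : exists i, h i == x by have [i <-] := h_surj x; exists i.
pose f := [ffun x => xchoose (h_surjb x)].
have fK x : h (f x) = x by rewrite ffunE; exact/eqP/(xchooseP (h_surjb x)).
have hK i : f (h i) = i by apply: h_inj; rewrite fK.
apply/existsP; exists f; apply/and3P; split.
- by apply/injectiveP; apply: (can_inj fK).
- by apply/forallP => i; apply/codomP; exists (h i).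
- by apply/forallP => x; apply/forallP => y; rewrite -h_adj !fK.
Qed.

Lemma set2_inj (T : finType) (a b c d : T) : [set a; b] = [set c; d] ->
  (a = c /\ b = d) \/ (a = d /\ b = c).
Proof.
move=> e.
have /set2P ha : a \in [set c; d] by rewrite -e set21.
have /set2P hb : b \in [set c; d] by rewrite -e set22.
have /set2P hc : c \in [set a; b] by rewrite e set21.
have /set2P hd : d \in [set a; b] by rewrite e set22.
case: ha; case: hb; case: hc; case: hd => *;
  first [by left; split; congruence | by right; split; congruence].
Qed.

Lemma edges_adj (G : sgraph) (x y : G) : adj x y -> [set x; y] \in edges G.
Proof. by move=> xy; apply/imsetP; exists (x, y); rewrite ?inE. Qed.

(** The first [n] values of [g] carry the required copy of P_n. Its edge set [F] is restricted to
    consecutive values, so further edges of [G] between these vertices do no harm. *)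
Lemma path_H_adjacent (n : nat) (G : sgraph) (g : nat -> G) (t : nat) :
  t.+2 < n -> (forall i j, i < n -> j < n -> g i = g j -> i = j) ->
  (forall i, i.+1 < n -> adj (g i) (g i.+1)) ->
  H_adjacent (path_graph n) [set g t; g t.+1] [set g t.+1; g t.+2].
Proof.
move=> tn g_inj g_adj.
pose S := [set g i | i : 'I_n].
pose F := [set [set g i; g i.+1] | i : 'I_n & i.+1 < n].
have gS i (lt_in : i < n) : g i \in S by apply/imsetP; exists (Ordinal lt_in).
have gF i : i.+1 < n -> [set g i; g i.+1] \in F.
  move=> lt_in; apply/imsetP; exists (Ordinal (ltnW lt_in)) => //.
  by rewrite inE.
apply/and3P; split.
- apply/eqP => /set2_inj [[e _]|[e _]]; apply g_inj in e; lia.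
- by apply/set0Pn; exists (g t.+1); rewrite !inE eqxx orbT.
apply/existsP; exists S; apply/existsP; exists F.
apply/and4P; split; [ | | by apply: gF; lia | by apply: gF].
  apply/andP; split.
    by apply/subsetP => e /imsetP [i]; rewrite inE => /g_adj/edges_adj ? ->.
  apply/forallP => e; apply/implyP => /imsetP [i]; rewrite inE => lt_in ->.
  by apply/subsetP => x /set2P [] ->; apply: gS; lia.
pose h (i : 'I_n) : subgraph S F := Sub (g i) (gS i (ltn_ord i)).
apply: (@isomorphic_bij _ (path_graph n) h).
- by move=> i j /(congr1 val) /= /g_inj e; apply/val_inj/e.
- case=> x xS; have /imsetP [i _ xi] := xS.
  by exists i; apply: val_inj; rewrite /= xi.
move=> i j; rewrite /= /subgraph_adj /path_adj /consecutive /=.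
have ii := ltn_ord i; have jj := ltn_ord j.
apply/andP/orP => [[_ /imsetP [l]]|].
  rewrite inE => lt_ln /set2_inj [] [] /g_inj e1 /g_inj e2; [left|right];
  by apply/eqP; have := e1 ltac:(lia) ltac:(lia); have := e2 ltac:(lia) ltac:(lia); lia.
case=> /eqP e; (split; first by apply/eqP => /g_inj; lia).
- by rewrite -e; apply: gF; lia.
- by rewrite -e setUC; apply: gF; lia.
Qed.

(** * Patterns on the natural numbers and their images under HL *)

(* A pattern is a directed graph on the first M natural numbers; only the
   underlying undirected edges matter. *)
Definition embeds (M : nat) (E : nat -> nat -> Prop) (G : sgraph) : Prop :=
  exists phi : nat -> G,
    (forall i j, i < M -> j < M -> phi i = phi j -> i = j) /\
    (forall i j, i < M -> j < M -> E i j -> adj (phi i) (phi j)).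

Lemma embeds_card (M : nat) (E : nat -> nat -> Prop) (G : sgraph) :
  embeds M E G -> M <= #|G|.
Proof.
case=> phi [phi_inj _]; rewrite -[M]card_ord.
by apply: (@leq_card _ _ (fun i : 'I_M => phi i)) => i j /phi_inj e; exact/val_inj/e.
Qed.

Lemma embeds_sub (M M' : nat) (E E' : nat -> nat -> Prop) (G : sgraph) :
  M' <= M -> (forall i j, i < M' -> j < M' -> E' i j -> E i j) ->
  embeds M E G -> embeds M' E' G.
Proof.
move=> leM sub [phi [phi_inj phi_adj]]; exists phi; split=> i j iM jM.
  by apply: phi_inj; lia.
by move/(sub i j iM jM); apply: phi_adj; lia.
Qed.

Definition pattern_path (M : nat) (E : nat -> nat -> Prop) (L : nat)
    (g : nat -> nat) : Prop :=
  [/\ forall a, a < L -> g a < M,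
      forall a b, a < L -> b < L -> g a = g b -> a = b
    & forall a, a.+1 < L -> E (g a) (g a.+1) \/ E (g a.+1) (g a)].

Definition same_edge (x y x' y' : nat) : Prop :=
  (x = x' /\ y = y') \/ (x = y' /\ y = x').

Definition path_joined (n M : nat) (E : nat -> nat -> Prop)
    (x y x' y' : nat) : Prop :=
  exists g L t, [/\ n <= L, t.+2 < L, pattern_path M E L g
    & (same_edge x y (g t) (g t.+1) /\ same_edge x' y' (g t.+1) (g t.+2)) \/
      (same_edge x' y' (g t) (g t.+1) /\ same_edge x y (g t.+1) (g t.+2))].

Lemma same_edge_set (T : finType) (phi : nat -> T) (x y x' y' : nat) :
  same_edge x y x' y' -> [set phi x; phi y] = [set phi x'; phi y'].
Proof. by case=> [] [-> ->] //; rewrite setUC. Qed.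

Lemma path_joined_H_adjacent (n M : nat) (E : nat -> nat -> Prop) (G : sgraph)
    (phi : nat -> G) (x y x' y' : nat) : 2 < n ->
  (forall i j, i < M -> j < M -> phi i = phi j -> i = j) ->
  (forall i j, i < M -> j < M -> E i j -> adj (phi i) (phi j)) ->
  path_joined n M E x y x' y' ->
  H_adjacent (path_graph n) [set phi x; phi y] [set phi x'; phi y'].
Proof.
move=> n_gt2 phi_inj phi_adj [g [L [t [leL tL [gM g_inj gE]]]]].
(* The stretch of [n] vertices starts at position [s], as close to [t] as the end of the path
   permits; [u] is the position of the first edge in it. *)
have [s [u [-> un sL]]] : exists s u, [/\ t = s + u, u.+2 < n & s + n <= L].
  by exists (minn t (L - n)), (t - minn t (L - n)); split; lia.
have adj_s : H_adjacent (path_graph n)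
    [set phi (g (s + u)); phi (g (s + u).+1)]
    [set phi (g (s + u).+1); phi (g (s + u).+2)].
  have := @path_H_adjacent n G (fun i => phi (g (s + i))) u un.
  rewrite /= !addnS; apply=> [i j iN jN /phi_inj e|i iN].
    suff : s + i = s + j by lia.
    by apply: g_inj; [lia..|]; apply: e; apply: gM; lia.
  rewrite addnS; have [e|e] := gE (s + i) ltac:(lia).
    by apply: phi_adj => //; apply: gM; lia.
  by rewrite adj_sym; apply: phi_adj => //; apply: gM; lia.
have symH (e f : {set G}) :
    H_adjacent (path_graph n) e f -> H_adjacent (path_graph n) f e.
  case/and3P=> ne meet /existsP [S /existsP [F /and4P [a b c d]]].
  apply/and3P; split; [by rewrite eq_sym | by rewrite setIC | ].
  by apply/existsP; exists S; apply/existsP; exists F; apply/and4P.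
by case=> [] [/(same_edge_set _ phi) -> /(same_edge_set _ phi) ->] //; apply: symH.
Qed.

(** Reduces a step of HL to arithmetic: vertex [i] of the new pattern is realised by the edge from
    [P i] to [Q i] of the old one. *)
Lemma embeds_HL (n M M' : nat) (E E' : nat -> nat -> Prop) (P Q : nat -> nat)
    (G : sgraph) : 2 < n -> 0 < M' ->
  (forall i, i < M' -> [/\ P i < M, Q i < M & E (P i) (Q i)]) ->
  (forall i j, i < M' -> j < M' -> same_edge (P i) (Q i) (P j) (Q j) -> i = j) ->
  (forall i j, i < M' -> j < M' -> E' i j ->
     path_joined n M E (P i) (Q i) (P j) (Q j)) ->
  embeds M E G -> embeds M' E' (HL (path_graph n) G).
Proof.
move=> n_gt2 M'_gt0 PQ_edge PQ_inj PQ_join [phi [phi_inj phi_adj]].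
have eP i : i < M' -> [set phi (P i); phi (Q i)] \in edges G.
  by case/PQ_edge => PM QM e; apply/edges_adj/phi_adj.
(* The default value is edge 0, which exists because [M'] is positive; below [M'] it is never
   taken. *)
pose psi i : {e | e \in edges G} :=
  insubd (exist (fun e => e \in edges G) _ (eP 0 M'_gt0))
    [set phi (P i); phi (Q i)].
have psiE i : i < M' -> val (psi i) = [set phi (P i); phi (Q i)].
  by move=> iM; rewrite val_insubd eP.
exists psi; split=> i j iM jM.
  move/(congr1 val); rewrite !psiE // => /set2_inj e; apply: PQ_inj => //.
  have [Pi Qi _] := PQ_edge i iM; have [Pj Qj _] := PQ_edge j jM.
  by case: e => [] [/phi_inj e1 /phi_inj e2]; [left|right]; split; auto.
move=> ij; rewrite /= /HL_adj !psiE //.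
by apply: (path_joined_H_adjacent _ M E) => //; apply: PQ_join.
Qed.

(** * Cycles with tails, and paths in them *)

(* A cycle on 0, ..., N-1 with two tails of t vertices rooted at 0 and p and a tail
   of s vertices rooted at q, numbered consecutively from N; o is the first vertex
   and u the number of vertices of the tail rooted at x. *)
Definition wheel_tail (N p q t s x o u : nat) : Prop :=
  [\/ [/\ x = 0, o = N & u = t], [/\ x = p, o = N + t & u = t]
    | [/\ x = q, o = N + 2 * t & u = s]].

(** The chord joins the two neighbours of 0 on the cycle: after a step of HL, vertex 0 is a tail
    edge just inserted, and its neighbours are the two cycle edges at the old root. *)
Inductive wheel (ch : bool) (N p q t s : nat) : nat -> nat -> Prop :=
  | WheelCycle x : x.+1 < N -> wheel ch N p q t s x x.+1
  | WheelClose : wheel ch N p q t s N.-1 0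
  | WheelRoot x o u : wheel_tail N p q t s x o u -> 0 < u ->
      wheel ch N p q t s x o
  | WheelTail x o u i : wheel_tail N p q t s x o u -> i.+1 < u ->
      wheel ch N p q t s (o + i) (o + i).+1
  | WheelChord : ch -> wheel ch N p q t s 1 N.-1.

Definition cyc_next (N x : nat) : nat := if x.+1 < N then x.+1 else 0.

(* Down a tail of u vertices, along len cycle vertices starting at x, and up a tail
   of u' vertices, which only enters through the number of steps. *)
Definition arc_path (N x len o u o' i : nat) : nat :=
  if i < u then o + (u - i.+1)
  else if i < u + len then
    if x + (i - u) < N then x + (i - u) else x + (i - u) - N
  else o' + (i - (u + len)).

(** An arc of at most [N] vertices does not meet itself, tails lie off the cycle, and tails with
    different first vertices are disjoint. The value 0 for [u] or [u'] means that the path has no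
    tail at that end; [x'] is the last vertex of the arc, taken modulo [N]. *)
Lemma arc_pathP (N p q t s x len o u x' o' u' : nat) :
  x < N -> 0 < len <= N ->
  u = 0 \/ wheel_tail N p q t s x o u ->
  u' = 0 \/ wheel_tail N p q t s x' o' u' ->
  u = 0 \/ u' = 0 \/ o <> o' -> x' < N ->
  x' = x + len.-1 \/ x' + N = x + len.-1 ->
  pattern_path (N + 2 * t + s) (wheel false N p q t s) (u + len + u')
    (arc_path N x len o u o').
Proof.
move=> xN lenN tail tail' ne x'N end'.
have o_range : u = 0 \/ N <= o /\ o + u <= N + 2 * t + s.
  by case: tail => [|[] [? ? ?]]; lia.
have o'_range : u' = 0 \/ N <= o' /\ o' + u' <= N + 2 * t + s.
  by case: tail' => [|[] [? ? ?]]; lia.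
have disj : u = 0 \/ u' = 0 \/ o + u <= o' \/ o' + u' <= o.
  case: tail tail' => [?|tail] [?|tail']; [by left.. | by right; left | ].
  by case: tail => -[? ? ?]; case: tail' => -[? ? ?]; lia.
split.
- move=> a aL; rewrite /arc_path; case: (ltnP a u) => ?; first by lia.
  case: (ltnP a (u + len)) => ?; first by case: (ltnP (x + (a - u)) N); lia.
  by lia.
- have wlog_inj a b : a < b -> b < u + len + u' ->
      arc_path N x len o u o' a = arc_path N x len o u o' b -> False.
    move=> ab bL; rewrite /arc_path; clear tail tail' ne end'.
    case: (ltnP a u) => ?; case: (ltnP b u) => ?; try lia.
      case: (ltnP b (u + len)) => ?; first by case: (ltnP (x + (b - u)) N); lia.
      by case: disj => ?; lia.
    case: (ltnP a (u + len)) => ?; case: (ltnP b (u + len)) => ?; try lia.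
      by case: (ltnP (x + (a - u)) N) => ?; case: (ltnP (x + (b - u)) N) => ?; lia.
    by case: (ltnP (x + (a - u)) N) => ?; lia.
  move=> a b aL bL e; case: (ltngtP a b) => // ab; exfalso.
    exact: (wlog_inj a b).
  exact: (wlog_inj b a).
- move=> a aL; rewrite /arc_path; clear disj o_range o'_range ne.
  case: (ltnP a u) => a_u.
    case: tail => [|tail]; first by lia.
    case: (ltnP a.+1 u) => a1_u.
      have -> : o + (u - a.+1) = (o + (u - a.+2)).+1 by lia.
      by right; apply: WheelTail tail _; lia.
    have -> : a.+1 < u + len by lia.
    have -> : x + (a.+1 - u) = x by lia.
    have -> : o + (u - a.+1) = o by lia.
    by rewrite xN; right; apply: WheelRoot tail _; lia.
  have -> : a.+1 < u = false by lia.
  case: (ltnP a (u + len)) => a_len; last first.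
    have -> : a.+1 < u + len = false by lia.
    case: tail' => [|tail']; first by lia.
    have -> : o' + (a.+1 - (u + len)) = (o' + (a - (u + len))).+1 by lia.
    by left; apply: WheelTail tail' _; lia.
  case: (ltnP a.+1 (u + len)) => a1_len.
    left; clear tail tail' end'.
    case: (ltnP (x + (a - u)) N) => ?; case: (ltnP (x + (a.+1 - u)) N) => ?; try lia.
    - have -> : x + (a.+1 - u) = (x + (a - u)).+1 by lia.
      by apply: WheelCycle; lia.
    - have -> : x + (a.+1 - u) - N = 0 by lia.
      have -> : x + (a - u) = N.-1 by lia.
      exact: WheelClose.
    - have -> : x + (a.+1 - u) - N = (x + (a - u) - N).+1 by lia.
      by apply: WheelCycle; lia.
  case: tail' => [|tail']; first by lia.
  have -> : (if x + (a - u) < N then x + (a - u) else x + (a - u) - N) = x'.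
    by clear tail tail'; case: (ltnP (x + (a - u)) N) => ?; lia.
  have -> : o' + (a.+1 - (u + len)) = o' by lia.
  by left; apply: WheelRoot tail' _; lia.
Qed.

(** * One step of HL on a cycle with tails *)

(* Oriented away from the cycle, the wheel has exactly one edge entering each
   vertex, so that its vertices also index its edges. *)
Definition wheel_parent (N p q t s v : nat) : nat :=
  if v == 0 then N.-1 else if v < N then v.-1 else
  if v == N then 0 else if v == N + t then p else
  if v == N + 2 * t then q else v.-1.

Definition wheel_joined (n N p q t s v w : nat) : Prop :=
  path_joined n (N + 2 * t + s) (wheel false N p q t s)
    (wheel_parent N p q t s v) v (wheel_parent N p q t s w) w.

Lemma path_joined_sym (n M : nat) (E : nat -> nat -> Prop) (x y x' y' : nat) :
  path_joined n M E x y x' y' -> path_joined n M E x' y' x y.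
Proof.
by case=> g [L [t [? ? ? []]]] ?; exists g, L, t; split=> //; [right | left].
Qed.

Ltac split_ifs := repeat (case: ifP => ?).

(** The new cycle consists of the cycle edges with the first edge of each tail inserted at its root;
    the other tail edges form the shortened tails. Only three kinds of pairs must be joined: two
    cycle edges at a vertex ([corner]), a cycle edge and the first tail edge at a root ([fork]), two
    successive tail edges ([tail]). The roots move to [p.+1] and [q.+2] since one and two tail edges
    are inserted before them. The case [q = N], [s = 0] is that of two tails. *)
Lemma wheel_HL (n N p q t s : nat) (G : sgraph) : 2 < n -> 2 < N -> 0 < t ->
  0 < p < q -> q < N /\ 0 < s \/ q = N /\ s = 0 ->
  (forall v, v < N -> wheel_joined n N p q t s v (cyc_next N v)) ->
  (forall x o u, 0 < u -> wheel_tail N p q t s x o u ->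
     wheel_joined n N p q t s x o /\ wheel_joined n N p q t s o (cyc_next N x)) ->
  (forall x o u i, i.+1 < u -> wheel_tail N p q t s x o u ->
     wheel_joined n N p q t s (o + i) (o + i).+1) ->
  embeds (N + 2 * t + s) (wheel false N p q t s) G ->
  let N' := if 0 < s then N.+3 else N.+2 in
  embeds (N' + 2 * t.-1 + s.-1) (wheel true N' p.+1 q.+2 t.-1 s.-1)
    (HL (path_graph n) G).
Proof.
move=> n_gt2 N_gt2 t_gt0 pq qN corner fork tail emb N'.
have N'E : 0 < s /\ N' = N.+3 \/ s = 0 /\ N' = N.+2.
  by rewrite /N'; case: (ltnP 0 s); lia.
clearbody N'.
have -> : N' + 2 * t.-1 + s.-1 = N + 2 * t + s by lia.
(* The edge entering 0 comes last on the new cycle, so in the enumeration [N] stands for 0. *)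
pose cy (v : nat) : nat := if v == N then 0 else v.
(* [Q i] is the end, away from its parent, of the old edge that becomes vertex [i]. *)
pose Q (i : nat) : nat :=
  if i == 0 then N else if i <= p then i else
  if i == p.+1 then N + t else
  if i < q.+2 then cy i.-1 else
  if i < N' then if i == q.+2 then N + 2 * t else cy (i - 2) else
  if i < N' + t.-1 then i.+1 - N' + N else
  if i < N' + 2 * t.-1 then i.+1 - (N' + t.-1) + (N + t)
  else i.+1 - (N' + 2 * t.-1) + (N + 2 * t).
have Q0 : Q 0 = N by [].
have Q1 i : 0 < i <= p -> Q i = i.
  by rewrite /Q; split_ifs; lia.
have Q2 : Q p.+1 = N + t.
  by rewrite /Q; split_ifs; lia.
have Q3 i : p.+1 < i < q.+2 -> Q i = cy i.-1.
  by rewrite /Q; split_ifs; lia.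
have Q4 : q.+2 < N' -> Q q.+2 = N + 2 * t.
  by rewrite /Q; split_ifs; lia.
have Q5 i : q.+2 < i < N' -> Q i = cy (i - 2).
  by rewrite /Q; split_ifs; lia.
have Q6 i : N' <= i < N' + t.-1 -> Q i = (i - N' + N).+1.
  by rewrite /Q; split_ifs; lia.
have Q7 i : N' + t.-1 <= i < N' + 2 * t.-1 -> Q i = (i - (N' + t.-1) + (N + t)).+1.
  by rewrite /Q; split_ifs; lia.
have Q8 i : N' + 2 * t.-1 <= i -> Q i = (i - (N' + 2 * t.-1) + (N + 2 * t)).+1.
  by rewrite /Q; split_ifs; lia.
clearbody Q.
have cyE v : v <= N -> (v < N /\ cy v = v) \/ (v = N /\ cy v = 0).
  by rewrite /cy; case: eqP; lia.
clearbody cy.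
(* A left inverse of [Q], which yields the injectivity of the enumeration. *)
pose K (w : nat) : nat :=
  if w == 0 then N'.-1 else if w <= p then w else
  if w < q.+1 then if w == N then 0 else w.+1 else
  if w < N then w.+2 else if w == N then 0 else
  if w == N + t then p.+1 else
  if w < N + t then w - N.+1 + N' else
  if (w == N + 2 * t) then q.+2 else
  if w < N + 2 * t then w - (N + t).+1 + (N' + t.-1)
  else w - (N + 2 * t).+1 + (N' + 2 * t.-1).
have QK i : i < N + 2 * t + s -> Q i < N + 2 * t + s /\ K (Q i) = i.
  move=> iM.
  have [->|i_gt0] := posnP i; first by rewrite Q0 /K; split_ifs; lia.
  have [ip|ip] := leqP i p; first by rewrite Q1 /K; split_ifs; lia.
  have [->|ip1] := eqVneq i p.+1; first by rewrite Q2 /K; split_ifs; lia.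
  have [iq|iq] := ltnP i q.+2.
    rewrite Q3; last by lia.
    by case: (cyE i.-1) => [|[? ->]|[? ->]]; rewrite /K /=; split_ifs; lia.
  have [iN|iN] := ltnP i N'.
    have [i_q2|iq2] := eqVneq i q.+2.
      by move: iN; rewrite i_q2 => iN; rewrite Q4 /K; split_ifs; lia.
    rewrite Q5; last by lia.
    by case: (cyE (i - 2)) => [|[? ->]|[? ->]]; rewrite /K /=; split_ifs; lia.
  have [it|it] := ltnP i (N' + t.-1); first by rewrite Q6 /K; split_ifs; lia.
  have [it2|it2] := ltnP i (N' + 2 * t.-1); first by rewrite Q7 /K; split_ifs; lia.
  by rewrite Q8 /K; split_ifs; lia.
have wheel_par v : v < N + 2 * t + s ->
  wheel false N p q t s (wheel_parent N p q t s v) v.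
  move=> vM; rewrite /wheel_parent.
  case: (eqVneq v 0) => [->|?]; first exact: WheelClose.
  case: ltnP => [?|?].
    by rewrite -{2}[v]prednK; [apply: WheelCycle|]; lia.
  have toTail x o u : wheel_tail N p q t s x o u -> o < v < o + u ->
      wheel false N p q t s v.-1 v.
    move=> tl ov; have -> : v = (o + (v - o.+1)).+1 by lia.
    by apply: WheelTail tl _; lia.
  case: eqVneq => [->|?].
    by apply: (@WheelRoot _ _ _ _ _ _ _ _ t); [constructor 1|].
  case: eqVneq => [->|?].
    by apply: (@WheelRoot _ _ _ _ _ _ _ _ t); [constructor 2|].
  case: eqVneq => [?|?].
    by subst v; apply: (@WheelRoot _ _ _ _ _ _ _ _ s); [constructor 3|lia].
  have [?|?] := ltnP v (N + t); first by apply: (@toTail 0 N t); [constructor 1|lia].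
  have [?|?] := ltnP v (N + 2 * t).
    by apply: (@toTail p (N + t) t); [constructor 2|lia].
  by apply: (@toTail q (N + 2 * t) s); [constructor 3|lia].
have par_lt v : 0 < v -> v < N + 2 * t + s -> wheel_parent N p q t s v < v.
  by rewrite /wheel_parent; split_ifs; lia.
(* Distinct indices could name the same edge only if each were the parent of the other. Parents are
   smaller, except that 0 has parent [N.-1], whose own parent is nonzero as [N] exceeds 2. *)
have par_inj v w : v < N + 2 * t + s -> w < N + 2 * t + s ->
    same_edge (wheel_parent N p q t s v) v (wheel_parent N p q t s w) w -> v = w.
  move=> vM wM [[_ //]|[vw wv]].
  have [v0|v0] := posnP v.
    by move: vw wv; rewrite v0 /wheel_parent /= => <-; split_ifs; lia.
  have [w0|w0] := posnP w.
    by move: vw; rewrite wv w0 /wheel_parent /=; split_ifs; lia.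
  by have := par_lt v v0 vM; have := par_lt w w0 wM; lia.
have step i j : i < N + 2 * t + s -> j < N + 2 * t + s ->
    wheel true N' p.+1 q.+2 t.-1 s.-1 i j -> wheel_joined n N p q t s (Q i) (Q j).
  have cy_lt v : v < N -> cy v = v.
    by move=> vN; case: (cyE v (ltnW vN)) => -[? ?] //; lia.
  have cyN : cy N = 0 by case: (cyE N (leqnn N)) => -[? ?] //; lia.
  have cyS v : v < N -> cy v.+1 = cyc_next N v.
    move=> vN; rewrite /cyc_next; case: ltnP => ?;
    by case: (cyE v.+1 vN) => -[? ?] //; lia.
  (* [fork_in] passes from the cycle edge entering a root to the tail edge there, [fork_out] from
     that tail edge to the cycle edge leaving the root. *)
  have fork_in x o u (u_gt0 : 0 < u) tl := (fork x o u u_gt0 tl).1.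
  have fork_out x o u (u_gt0 : 0 < u) tl := (fork x o u u_gt0 tl).2.
  have tail0 : wheel_tail N p q t s 0 N t by constructor 1.
  have tailp : wheel_tail N p q t s p (N + t) t by constructor 2.
  have tailq : wheel_tail N p q t s q (N + 2 * t) s by constructor 3.
  have QN : Q N'.-1 = 0.
    case: (N'E) => -[s0 N'e].
      by rewrite Q5; [have -> : N'.-1 - 2 = N by lia | lia].
    by rewrite Q3; [have -> : N'.-1.-1 = N by lia | lia].
  move=> + + W; case: W => {i j}.
  - move=> i iN _ _.
    have [->|i_gt0] := posnP i.
      have -> : Q 1 = cyc_next N 0 by rewrite /cyc_next Q1; [case: ltnP|]; lia.
      by rewrite Q0; apply: fork_out tail0.
    have [ip|ip] := ltnP i p.
      have -> : Q i.+1 = cyc_next N i by rewrite /cyc_next Q1; [case: ltnP|]; lia.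
      by rewrite Q1; [apply: corner|]; lia.
    have [->|ip1] := eqVneq i p.
      by rewrite Q2 Q1; [apply: fork_in tailp|lia].
    have [->|ip2] := eqVneq i p.+1.
      by rewrite Q2 Q3 /= ?cyS; [apply: fork_out tailp| |]; lia.
    have [iq|iq] := ltnP i q.+1.
      have -> : Q i.+1 = cyc_next N i.-1 by rewrite Q3 /= -?cyS ?prednK //; lia.
      by rewrite Q3 ?cy_lt; [apply: corner| |]; lia.
    have [i_q|iq1] := eqVneq i q.+1.
      move: iN; rewrite i_q => iN.
      by rewrite Q4 // Q3 /= ?cy_lt; [apply: fork_in tailq| |]; lia.
    have [i_q|iq2] := eqVneq i q.+2.
      move: iN; rewrite i_q => iN.
      by rewrite Q4 1?Q5 ?subSS ?subn0 ?cyS; [apply: fork_out tailq| | |]; lia.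
    have -> : Q i.+1 = cyc_next N (i - 2).
      by rewrite -cyS ?Q5; [congr cy| |]; lia.
    by rewrite Q5 ?cy_lt; [apply: corner| |]; lia.
  - by move=> _ _; rewrite QN Q0; apply: fork_in tail0.
  - move=> x o u [] [-> -> ->] u_gt0 xM oM.
    + have := tail 0 N t 0 ltac:(lia) tail0; rewrite addn0 Q0 Q6; last by lia.
      by rewrite subnn.
    + have := tail p (N + t) t 0 ltac:(lia) tailp; rewrite addn0 Q2 Q7; last by lia.
      by rewrite subnn.
    + have := tail q (N + 2 * t) s 0 ltac:(lia) tailq; rewrite addn0 Q4 ?Q8; [|lia..].
      by rewrite subnn.
  - move=> x o u i [] [_ -> ->] iu iM jM.
    + have := tail 0 N t i.+1 ltac:(lia) tail0; rewrite !Q6; [|lia..].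
      by congr (wheel_joined _ _ _ _ _ _ _ _); lia.
    + have := tail p (N + t) t i.+1 ltac:(lia) tailp; rewrite !Q7; [|lia..].
      by congr (wheel_joined _ _ _ _ _ _ _ _); lia.
    + have := tail q (N + 2 * t) s i.+1 ltac:(lia) tailq; rewrite !Q8; [|lia..].
      by congr (wheel_joined _ _ _ _ _ _ _ _); lia.
  (* The chord comes from the corner at the old root 0. *)
  - move=> _ _ _; rewrite QN Q1; last by lia.
    have := corner 0 ltac:(lia); rewrite /cyc_next.
    by case: ltnP; [move=> _; apply: path_joined_sym | lia].
have M_gt0 : 0 < N + 2 * t + s by lia.
apply: (@embeds_HL n _ _ _ _ (fun i => wheel_parent N p q t s (Q i)) Q _ n_gt2 M_gt0
  _ _ step emb).
- move=> i /QK [QM _]; have := wheel_par _ QM => W; split=> //.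
  by rewrite /wheel_parent; split_ifs; lia.
- move=> i j iM jM; have [Qi Ki] := QK i iM; have [Qj Kj] := QK j jM.
  by move/(par_inj _ _ Qi Qj) => e; rewrite -Ki e Kj.
Qed.

(** * Joined pairs of edges along an arc *)

Lemma wheel_parent_next (N p q t s v : nat) : 1 < N -> v < N ->
  wheel_parent N p q t s (cyc_next N v) = v.
Proof.
move=> ? ?; rewrite /cyc_next; case: ltnP => ?;
  by rewrite /wheel_parent /=; split_ifs; lia.
Qed.

Lemma wheel_parent_root (N p q t s x o u : nat) : 0 < N -> 0 < t ->
  wheel_tail N p q t s x o u -> wheel_parent N p q t s o = x.
Proof. by move=> ? ? [] [-> -> _]; rewrite /wheel_parent; split_ifs; lia. Qed.

Lemma wheel_parent_tail (N p q t s x o u i : nat) :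
  wheel_tail N p q t s x o u -> i.+1 < u ->
  wheel_parent N p q t s (o + i).+1 = o + i.
Proof. by move=> [] [_ -> ->] ?; rewrite /wheel_parent; split_ifs; lia. Qed.

(** One path down a tail, along an arc and up a tail serves all these pairs at once, as each is
    consecutive on it: corners inside the arc, the turns at its two ends, and the inside of the
    first tail. The inside of the other tail is left to a path that starts there. *)
Lemma arc_joined (n N p q t s x len o u x' o' u' : nat) :
  0 < t -> x < N -> 1 < len <= N -> n <= u + len + u' ->
  u = 0 \/ wheel_tail N p q t s x o u ->
  u' = 0 \/ wheel_tail N p q t s x' o' u' ->
  u = 0 \/ u' = 0 \/ o <> o' -> x' < N ->
  x' = x + len.-1 \/ x' + N = x + len.-1 ->
  [/\ forall v d, d.+2 < len -> v = x + d.+1 \/ v + N = x + d.+1 -> v < N ->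
        wheel_joined n N p q t s v (cyc_next N v),
      0 < u -> wheel_joined n N p q t s o (cyc_next N x),
      0 < u' -> wheel_joined n N p q t s x' o'
    & forall i, i.+1 < u -> wheel_joined n N p q t s (o + i) (o + i).+1].
Proof.
move=> t_gt0 xN lenN leL tail tail' ne x'N end'.
have len_gt0 : 0 < len <= N by lia.
have gP := arc_pathP N p q t s x len o u x' o' u' xN len_gt0 tail tail' ne x'N end'.
set g := arc_path N x len o u o' in gP.
have g_init i : i < u -> g (u - i.+1) = o + i.
  by move=> iu; rewrite /g /arc_path; case: ifP; lia.
have g_mid d v : d < len -> v = x + d \/ v + N = x + d -> v < N -> g (u + d) = v.
  by move=> dl vx vN; rewrite /g /arc_path; split_ifs; lia.
have g_final i : g (u + len + i) = o' + i.
  by rewrite /g /arc_path; split_ifs; lia.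
have nextE v : v < N -> cyc_next N v = v.+1 \/ v.+1 = N /\ cyc_next N v = 0.
  by move=> ?; rewrite /cyc_next; split_ifs; lia.
have next_lt v : v < N -> cyc_next N v < N.
  by move=> ?; rewrite /cyc_next; split_ifs; lia.
have N_gt1 : 1 < N by lia.
have par_next v := wheel_parent_next N p q t s v N_gt1.
have prevE v : v < N -> exists2 w, w < N & v = cyc_next N w.
  case: v => [|v] vN; [exists N.-1 | exists v]; rewrite /cyc_next; try lia;
  by split_ifs; lia.
have next_mid d v : d.+1 < len -> v = x + d \/ v + N = x + d -> v < N ->
    g (u + d).+1 = cyc_next N v.
  move=> dl vx vN; rewrite -addnS; apply: g_mid; [lia| |exact: next_lt].
  by case: (nextE v vN); lia.
have par_root y r w : wheel_tail N p q t s y r w -> wheel_parent N p q t s r = y.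
  by apply: wheel_parent_root; lia.
split.
- move=> v d dl vx vN; exists g, (u + len + u'), (u + d); split=> //; first by lia.
  have [w wN vE] := prevE v vN.
  have gw : g (u + d) = w.
    by apply: g_mid => //; [lia|]; case: (nextE w wN) => [|[]]; lia.
  have gv : g (u + d).+1 = v by rewrite -addnS; apply: g_mid => //; lia.
  have gv' : g (u + d).+2 = cyc_next N v by rewrite -addnS; apply: next_mid; lia.
  left; rewrite gw gv gv' par_next // {1 2}vE par_next //.
  by split; left; split.
- move=> u_gt0; case: tail => [|tail]; first by lia.
  exists g, (u + len + u'), (u - 1); split=> //; first by lia.
  have -> : (u - 1).+1 = u + 0 by lia.
  rewrite (g_init 0) // (next_mid 0 x) ?(g_mid 0 x) //; [|lia..].
  rewrite par_next // (par_root _ _ _ tail) addn0.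
  by left; split; [right | left].
- move=> u'_gt0; case: tail' => [|tail']; first by lia.
  exists g, (u + len + u'), (u + len - 2); split=> //; [lia..|].
  have [w wN wE] := prevE x' x'N.
  have -> : g (u + len - 2) = w.
    have -> : u + len - 2 = u + (len - 2) by lia.
    by apply: g_mid => //; [lia|]; case: (nextE w wN) => [|[]]; lia.
  have -> : g (u + len - 2).+1 = x'.
    have -> : (u + len - 2).+1 = u + (len.-1) by lia.
    by apply: g_mid => //; lia.
  have -> : g (u + len - 2).+2 = o'.
    have -> : (u + len - 2).+2 = u + len + 0 by lia.
    by rewrite g_final addn0.
  rewrite (par_root _ _ _ tail') {1 2}wE par_next // -?wE.
  by left; split; left.
- move=> i iu; case: tail => [|tail]; first by lia.
  exists g, (u + len + u'), (u - i.+2); split=> //; first by lia.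
  have -> : g (u - i.+2) = (o + i).+1 by rewrite -addnS -g_init.
  have -> : g (u - i.+2).+1 = o + i.
    by rewrite -g_init; [congr g|]; lia.
  rewrite (wheel_parent_tail _ _ _ _ _ _ _ _ _ tail iu).
  right; split; first by right.
  (* On the way down, [o + i] is followed by the root if [i] is 0, and by another tail vertex
     otherwise. *)
  case: i iu => [|i] iu.
    have -> : g (u - 2).+2 = x.
      by rewrite (_ : (u - 2).+2 = u + 0); [apply: g_mid|]; lia.
    by rewrite addn0 (par_root _ _ _ tail); right.
  have -> : g (u - i.+3).+2 = o + i.
    by rewrite -g_init; [congr g|]; lia.
  rewrite addnS (wheel_parent_tail _ _ _ _ _ _ _ _ _ tail); last by lia.
  by right.
Qed.

(** * The stages: three tails, two tails, chorded cycle *)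

Lemma wheel_chordS (N p q t s x y : nat) :
  wheel false N p q t s x y -> wheel true N p q t s x y.
Proof.
case=> [i iN||i o u tl u_gt0|i o u j tl ju|//].
- exact: WheelCycle.
- exact: WheelClose.
- exact: WheelRoot tl u_gt0.
- exact: WheelTail tl ju.
Qed.

(** With the roots a third of the cycle apart, an arc from a root to the next but one has
    [2 * r + 1] vertices. A step adds two vertices to it and takes one from each tail, so both lower
    bounds persist. *)
Lemma wheel_HL_three_tails (n r t s : nat) (G : sgraph) :
  2 < n -> 0 < r -> 0 < t -> 0 < s ->
  n <= 2 * r + 1 + t + s -> n <= 2 * r + 1 + 2 * t ->
  embeds (3 * r + 2 * t + s) (wheel false (3 * r) r (2 * r) t s) G ->
  embeds (3 * r.+1 + 2 * t.-1 + s.-1)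
    (wheel false (3 * r.+1) r.+1 (2 * r.+1) t.-1 s.-1) (HL (path_graph n) G).
Proof.
move=> n_gt2 r_gt0 t_gt0 s_gt0 nts ntt emb.
pose tl := wheel_tail (3 * r) r (2 * r) t s.
have tla : tl 0 (3 * r) t by constructor 1.
have tlb : tl r (3 * r + t) t by constructor 2.
have tlc : tl (2 * r) (3 * r + 2 * t) s by constructor 3.
have r1 : 1 < (2 * r).+1 <= 3 * r by lia.
(* The paths a, b, c start in the tails at [0], [r], [2 * r] and end in those at [2 * r], [0], [r];
   every cycle vertex is inside one of the three arcs. *)
have [corner_a out_a in_c tail_a] := arc_joined n (3 * r) r (2 * r) t s
  0 (2 * r).+1 (3 * r) t (2 * r) (3 * r + 2 * t) s t_gt0 ltac:(lia) r1 ltac:(lia)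
  (or_intror tla) (or_intror tlc) ltac:(lia) ltac:(lia) ltac:(lia).
have [corner_b out_b in_a tail_b] := arc_joined n (3 * r) r (2 * r) t s
  r (2 * r).+1 (3 * r + t) t 0 (3 * r) t t_gt0 ltac:(lia) r1 ltac:(lia)
  (or_intror tlb) (or_intror tla) ltac:(lia) ltac:(lia) ltac:(lia).
have [corner_c out_c in_b tail_c] := arc_joined n (3 * r) r (2 * r) t s
  (2 * r) (2 * r).+1 (3 * r + 2 * t) s r (3 * r + t) t t_gt0 ltac:(lia) r1 ltac:(lia)
  (or_intror tlc) (or_intror tlb) ltac:(lia) ltac:(lia) ltac:(lia).
have -> : 3 * r.+1 = (3 * r).+3 by lia.
have -> : 2 * r.+1 = (2 * r).+2 by lia.
apply: embeds_sub (leqnn _) _ _; first by move=> i j _ _; apply: wheel_chordS.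
have := @wheel_HL n (3 * r) r (2 * r) t s G n_gt2 ltac:(lia) t_gt0 ltac:(lia) ltac:(lia).
rewrite s_gt0; apply=> //.
- move=> v vN; have [v_r|v_r] := leqP v r.
    have [v0|v_gt0] := posnP v; first by apply: (corner_c _ r.-1); lia.
    by apply: (corner_a _ v.-1); lia.
  have [v_r2|v_r2] := leqP v (2 * r).
    by apply: (corner_b _ (v - r.+1)); lia.
  by apply: (corner_b _ (v - r.+1)); lia.
- by move=> x o u u_gt0 [] [-> -> _]; split; auto.
- move=> x o u i iu [] [_ -> uE]; [apply: tail_a | apply: tail_b | apply: tail_c]; lia.
Qed.

(* The third tail is empty; its root is placed at N, outside the cycle. *)
Lemma wheel_HL_two_tails (n N p t : nat) (G : sgraph) :
  2 < n -> 2 < N -> 0 < p -> p.+1 < N -> 0 < t -> n <= N + t ->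
  embeds (N + 2 * t) (wheel false N p N t 0) G ->
  embeds (N.+2 + 2 * t.-1) (wheel true N.+2 p.+1 N.+2 t.-1 0) (HL (path_graph n) G).
Proof.
move=> n_gt2 N_gt2 p_gt0 pN t_gt0 nN emb.
have N1 : 1 < N <= N by lia.
pose tl := wheel_tail N p N t 0.
have tla : tl 0 N t by constructor 1.
have tlb : tl p (N + t) t by constructor 2.
(* Each path uses one tail and the whole cycle, [N + t] vertices in all; the unprimed ones start
   with the tail, the primed ones end with it. *)
have [corner_a out_a _ tail_a] := arc_joined n N p N t 0
  0 N N t N.-1 0 0 t_gt0 ltac:(lia) N1 ltac:(lia)
  (or_intror tla) (or_introl erefl) ltac:(lia) ltac:(lia) ltac:(lia).
have [_ out_b _ tail_b] := arc_joined n N p N t 0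
  p N (N + t) t p.-1 0 0 t_gt0 ltac:(lia) N1 ltac:(lia)
  (or_intror tlb) (or_introl erefl) ltac:(lia) ltac:(lia) ltac:(lia).
have [corner_a' _ in_a _] := arc_joined n N p N t 0
  1 N 0 0 0 N t t_gt0 ltac:(lia) N1 ltac:(lia)
  (or_introl erefl) (or_intror tla) ltac:(lia) ltac:(lia) ltac:(lia).
have [corner_b' _ in_b _] := arc_joined n N p N t 0
  p.+1 N 0 0 p (N + t) t t_gt0 ltac:(lia) N1 ltac:(lia)
  (or_introl erefl) (or_intror tlb) ltac:(lia) ltac:(lia) ltac:(lia).
have := @wheel_HL n N p N t 0 G n_gt2 N_gt2 t_gt0 ltac:(lia) ltac:(lia).
rewrite /= !addn0; apply=> //.
(* Paths with the tail at 0 begin or end their turn of the cycle at 0, so the corner there needs the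
   tail at [p]. *)
- move=> v vN; have [v0|v_gt0] := posnP v; first by apply: (corner_b' _ (N - p.+2)); lia.
  have [v_N|v_N] := ltnP v.+1 N; first by apply: (corner_a _ v.-1); lia.
  by apply: (corner_a' _ (N - 3)); lia.
- by move=> x o u u_gt0 [] [-> -> uE]; split; auto; move: u_gt0; rewrite uE.
- move=> x o u i iu [] [_ -> uE]; [apply: tail_a | apply: tail_b |]; lia.
Qed.

(** The chord is inserted at its end 1 between the cycle edges 01 and 12; these meet at 1 and give
    the new chord, which again joins the neighbours of 0. All adjacencies come from Hamiltonian
    paths, which have [N] vertices. *)
Lemma chorded_cycle_HL (n N p q : nat) (G : sgraph) : 2 < n -> n <= N -> 3 < N ->
  embeds N (wheel true N p q 0 0) G ->
  embeds N.+1 (wheel true N.+1 p q 0 0) (HL (path_graph n) G).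
Proof.
move=> n_gt2 nN N_gt3.
pose E := wheel true N p q 0 0.
have E_cycle x : x.+1 < N -> E x x.+1 by apply: WheelCycle.
have E_close : E N.-1 0 by apply: WheelClose.
have E_chord : E 1 N.-1 by apply: WheelChord.
have E_next w : w < N -> E w (cyc_next N w).
  move=> wN; rewrite /cyc_next; case: (ltnP w.+1 N) => ?; first exact: E_cycle.
  by rewrite (_ : w = N.-1) //; lia.
have around w v : w < N -> v = cyc_next N w ->
    path_joined n N E w v v (cyc_next N v).
  (* [w'] precedes [w] on the cycle and ends the full turn that starts at [w]. *)
  move=> wN ->; pose w' := if w == 0 then N.-1 else w.-1.
  have [w'N w'E] : w' < N /\ (w' = w + N.-1 \/ w' + N = w + N.-1).
    by rewrite /w'; split_ifs; lia.
  have := arc_pathP N p q 0 0 w N 0 0 w' 0 0 wN ltac:(lia)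
    (or_introl erefl) (or_introl erefl) (or_introl erefl) w'N w'E.
  rewrite muln0 !addn0; case.
  move=> gN g_inj gE; exists (arc_path N w N 0 0 0), N, 0; split=> //; first by lia.
    by split=> // a aN; case: (gE a aN) => W; [left | right]; apply: wheel_chordS.
  left; rewrite /arc_path /= !subn0 addn0 wN.
  have [-> -> ->] : [/\ 0 < N, 1 < N & 2 < N] by split; lia.
  have -> : (if w + 1 < N then w + 1 else w + 1 - N) = cyc_next N w.
    by rewrite addn1 /cyc_next; split_ifs; lia.
  have -> : (if w + 2 < N then w + 2 else w + 2 - N) = cyc_next N (cyc_next N w).
    by rewrite addn2 /cyc_next; case: (ltnP w.+1 N) => ?; split_ifs; lia.
  by split; left.
have next0 : cyc_next N 0 = 1 by rewrite /cyc_next; split_ifs; lia.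
have next1 : cyc_next N 1 = 2 by rewrite /cyc_next; split_ifs; lia.
have chord_up : path_joined n N E 1 N.-1 1 2.
  (* The path 0, N-1, 1, 2, ..., N-2. *)
  pose g i := if i == 0 then 0 else if i == 1 then N.-1 else i.-1.
  exists g, N, 1; split; [by [] | by lia | | by left; split; [right | left]].
  split.
  - by move=> a aN; rewrite /g; split_ifs; lia.
  - by move=> a b aN bN; rewrite /g; split_ifs; lia.
  - case=> [|[|a]] aN; [by right | by right | left].
    by apply: (E_cycle a.+1); lia.
have chord_down : path_joined n N E 0 1 1 N.-1.
  (* The path 2, 3, ..., N-1, 1, 0. *)
  pose g i := if i < N - 2 then i.+2 else if i == N - 2 then 1 else 0.
  have gE0 : g (N - 3) = N.-1 by rewrite /g; split_ifs; lia.
  have gE1 : g (N - 3).+1 = 1 by rewrite /g; split_ifs; lia.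
  have gE2 : g (N - 3).+2 = 0 by rewrite /g; split_ifs; lia.
  exists g, N, (N - 3); split; [by [] | by lia | | ].
    split.
    - by move=> a aN; rewrite /g; split_ifs; lia.
    - by move=> a b aN bN; rewrite /g; split_ifs; lia.
    - move=> a aN; have [a_lt|a_ge] := ltnP a (N - 3).
        left; rewrite /g; have -> : a < N - 2 by lia.
        have -> : a.+1 < N - 2 by lia.
        by apply: E_cycle; lia.
      right; have [->|a_ne] := eqVneq a (N - 3); first by rewrite gE0 gE1.
      have -> : a = (N - 3).+1 by lia.
      by rewrite gE1 gE2; apply: E_cycle; lia.
  by right; rewrite gE0 gE1 gE2; split; right.
(* Index 0 is the chord, so the cycle edge from 0 to 1 gets index [N], which [w] sends back to 0. *)
pose w i := if i < N then i else 0.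
pose P i := if i == 0 then 1 else w i.
pose Q i := if i == 0 then N.-1 else cyc_next N (w i).
have PQE i : i < N.+1 -> [/\ P i < N, Q i < N & E (P i) (Q i)].
  move=> iN; rewrite /P /Q; case: eqP => [_|i0]; first by split=> //; lia.
  have wN : w i < N by rewrite /w; split_ifs; lia.
  by split=> //; [rewrite /cyc_next; split_ifs; lia | apply: E_next].
have PQ_inj i j : i < N.+1 -> j < N.+1 -> same_edge (P i) (Q i) (P j) (Q j) -> i = j.
  move=> iN jN; rewrite /same_edge /P /Q /w /cyc_next.
  by case: (eqVneq i 0) => ?; case: (eqVneq j 0) => ?;
    case: (ltnP i N) => ?; case: (ltnP j N) => ?; split_ifs; lia.
apply: (@embeds_HL n _ _ _ _ P Q) => //.
move=> i j iN jN W; case: W iN jN => {i j}.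
- move=> i iN _ _; rewrite /P /Q /=; case: (eqVneq i 0) => [->|i0].
    by rewrite /w (_ : 1 < N) ?next1 //; lia.
  have -> : w i = i by rewrite /w; split_ifs; lia.
  have -> : w i.+1 = cyc_next N i by [].
  by apply: around => //; lia.
- by move=> _ _; rewrite /P /Q /w /= ltnn next0; case: eqP => [|_ //]; lia.
- by move=> x o u [] [_ _ ->].
- by move=> x o u i [] [_ _ ->].
- move=> _ _ _; rewrite /P /Q /w /= ltnn next0.
  have -> : 1 < N by lia.
  case: eqP => [|_]; first by lia.
  by apply/path_joined_sym/around; [lia | rewrite next0].
Qed.

(** * The spider CL(k,k,m) and the first step of HL *)

(** The centre is 0 and each leg is numbered outwards; [o] is the first vertex of a leg and [u] its
    number of vertices. *)
Definition spider_leg (k m o u : nat) : Prop :=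
  [\/ o = 1 /\ u = k, o = k.+1 /\ u = k | o = (2 * k).+1 /\ u = m].

Inductive spider (k m : nat) : nat -> nat -> Prop :=
  | SpiderRoot o u : spider_leg k m o u -> 0 < u -> spider k m 0 o
  | SpiderLeg o u i : spider_leg k m o u -> i.+1 < u ->
      spider k m (o + i) (o + i).+1.

Lemma embeds_CL (k m : nat) :
  embeds (2 * k + m).+1 (spider k m) (CL k k m).
Proof.
pose inl1 (i : 'I_k) : CL k k m := Some (inl (inl i)).
pose inl2 (i : 'I_k) : CL k k m := Some (inl (inr i)).
pose inl3 (i : 'I_m) : CL k k m := Some (inr i).
pose psi (v : nat) : CL k k m :=
  if insub v is Some i then inl1 i else
  if insub (v - k) is Some i then inl2 i else
  if insub (v - 2 * k) is Some i then inl3 i else None.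
pose phi (v : nat) : CL k k m := if v is v'.+1 then psi v' else None.
have phi1 (i : 'I_k) : phi (1 + i) = inl1 i by rewrite /phi /psi /= valK.
have phi2 (i : 'I_k) : phi (k.+1 + i) = inl2 i.
  rewrite addSn /phi /psi insubF; last by lia.
  by rewrite addKn valK.
have phi3 (i : 'I_m) : phi ((2 * k).+1 + i) = inl3 i.
  rewrite addSn /phi /psi insubF; last by lia.
  by rewrite insubF; [rewrite addKn valK | lia].
have cover v : v < (2 * k + m).+1 -> [\/ v = 0, exists i : 'I_k, v = 1 + i,
    exists i : 'I_k, v = k.+1 + i | exists i : 'I_m, v = (2 * k).+1 + i].
  move=> vM; have [->|v0] := eqVneq v 0; first by constructor 1.
  have [vk|vk] := ltnP v.-1 k.
    by constructor 2; exists (Ordinal vk) => /=; lia.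
  have [vk2|vk2] := ltnP (v - k.+1) k.
    by constructor 3; exists (Ordinal vk2) => /=; lia.
  have vm : v - (2 * k).+1 < m by lia.
  by constructor 4; exists (Ordinal vm) => /=; lia.
have phi0 : phi 0 = None by [].
exists phi; split.
  move=> v w /cover + /cover.
  by case=> [->|[i ->]|[i ->]|[i ->]]; case=> [->|[j ->]|[j ->]|[j ->]] //;
    rewrite ?phi0 ?phi1 ?phi2 ?phi3 // => -[->].
have phi1n i (ik : i < k) : phi (1 + i) = inl1 (Ordinal ik) := phi1 (Ordinal ik).
have phi2n i (ik : i < k) : phi (k.+1 + i) = inl2 (Ordinal ik) := phi2 (Ordinal ik).
have phi3n i (im : i < m) : phi ((2 * k).+1 + i) = inl3 (Ordinal im) :=
  phi3 (Ordinal im).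
move=> v w _ _; case=> {v w} [o u|o u i] leg iu.
  rewrite phi0 -[o]addn0.
  case: leg => -[oE uE]; subst o u.
  - by rewrite (phi1n 0 iu).
  - by rewrite (phi2n 0 iu).
  - by rewrite (phi3n 0 iu).
rewrite -addnS; case: leg => -[oE uE]; subst o u.
- by rewrite (phi1n i (ltnW iu)) (phi1n i.+1 iu) /= /consecutive eqxx.
- by rewrite (phi2n i (ltnW iu)) (phi2n i.+1 iu) /= /consecutive eqxx.
- by rewrite (phi3n i (ltnW iu)) (phi3n i.+1 iu) /= /consecutive eqxx.
Qed.

Definition leg_path (o u o' i : nat) : nat :=
  if i < u then o + (u - i.+1) else if i == u then 0 else o' + (i - u.+1).

Lemma leg_pathP (k m o u o' u' : nat) :
  spider_leg k m o u -> spider_leg k m o' u' -> o <> o' -> 0 < k -> 0 < m ->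
  pattern_path (2 * k + m).+1 (spider k m) (u + u').+1 (leg_path o u o').
Proof.
move=> leg leg' ne k_gt0 m_gt0.
have u_gt0 : 0 < u by case: leg => -[]; lia.
have u'_gt0 : 0 < u' by case: leg' => -[]; lia.
have o_range : 0 < o /\ o + u <= (2 * k + m).+1 by case: leg => -[? ?]; lia.
have o'_range : 0 < o' /\ o' + u' <= (2 * k + m).+1 by case: leg' => -[? ?]; lia.
have disj : o + u <= o' \/ o' + u' <= o.
  by case: leg => -[? ?]; case: leg' => -[? ?]; lia.
split.
- by move=> a aL; rewrite /leg_path; split_ifs; lia.
- by move=> a b aL bL; rewrite /leg_path; split_ifs; lia.
- move=> a aL; rewrite /leg_path; have [a_u|a_u] := ltnP a u.
    right; have [a1_u|a1_u] := ltnP a.+1 u.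
      have -> : o + (u - a.+1) = (o + (u - a.+2)).+1 by lia.
      by apply: SpiderLeg leg _; lia.
    have -> : a.+1 == u by lia.
    have -> : o + (u - a.+1) = o by lia.
    exact: SpiderRoot leg _.
  left; have -> : (a.+1 < u) = false by lia.
  have -> : (a.+1 == u) = false by lia.
  have [->|a_ne] := eqVneq a u.
    have -> : o' + (u.+1 - u.+1) = o' by lia.
    exact: SpiderRoot leg' _.
  have -> : o' + (a.+1 - u.+1) = (o' + (a - u.+1)).+1 by lia.
  by apply: SpiderLeg leg' _; lia.
Qed.

(** The path formed by two legs and the centre has [2 * k + 1] or [k + m + 1] vertices, so the three
    edges at the centre become a triangle, and the rest of each leg becomes a tail. *)
Lemma spider_HL (n k m : nat) (G : sgraph) : 2 < n -> 1 < k -> 0 < m ->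
  n <= (2 * k).+1 -> n <= (k + m).+1 ->
  embeds (2 * k + m).+1 (spider k m) G ->
  embeds (3 + 2 * k.-1 + m.-1) (wheel false 3 1 2 k.-1 m.-1) (HL (path_graph n) G).
Proof.
move=> n_gt2 k_gt1 m_gt0 n2k nkm emb.
pose par v := if [|| v == 1, v == k.+1 | v == (2 * k).+1] then 0 else v.-1.
have par_root o u : spider_leg k m o u -> par o = 0.
  by case=> -[-> _]; rewrite /par eqxx ?orbT.
have par_leg o u i : spider_leg k m o u -> i.+1 < u -> par (o + i).+1 = o + i.
  by case=> -[-> ->] ?; rewrite /par; case: ifP; lia.
have leg1 : spider_leg k m 1 k by constructor 1.
have leg2 : spider_leg k m k.+1 k by constructor 2.
have leg3 : spider_leg k m (2 * k).+1 m by constructor 3.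
have spider_par v : 0 < v < (2 * k + m).+1 -> spider k m (par v) v.
  move=> vM; have toLeg o u : spider_leg k m o u -> o < v < o + u ->
      spider k m (par v) v.
    move=> leg ov; have -> : v = (o + (v - o.+1)).+1 by lia.
    by rewrite (par_leg _ _ _ leg); [apply: SpiderLeg leg _|]; lia.
  have toRoot u : 0 < u -> spider_leg k m v u -> spider k m (par v) v.
    by move=> ? leg; rewrite (par_root _ _ leg); apply: SpiderRoot leg _.
  have [v1|v1] := eqVneq v 1; first by apply: (toRoot k); [lia | constructor 1].
  have [v2|v2] := eqVneq v k.+1; first by apply: (toRoot k); [lia | constructor 2].
  have [v3|v3] := eqVneq v (2 * k).+1; first by apply: (toRoot m); [lia | constructor 3].
  have [?|?] := ltnP v k.+1; first by apply: (toLeg _ _ leg1); lia.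
  have [?|?] := ltnP v (2 * k).+1; first by apply: (toLeg _ _ leg2); lia.
  by apply: (toLeg _ _ leg3); lia.
have par_lt v : 0 < v -> par v < v by rewrite /par; case: ifP; lia.
pose J v w := path_joined n (2 * k + m).+1 (spider k m) (par v) v (par w) w.
have joined o u o' u' : spider_leg k m o u -> spider_leg k m o' u' -> o <> o' ->
    J o o' /\ forall i, i.+1 < u -> J (o + i) (o + i).+1.
  move=> leg leg' ne.
  have gP := leg_pathP k m o u o' u' leg leg' ne (ltnW k_gt1) m_gt0.
  set g := leg_path o u o' in gP.
  have u_gt0 : 0 < u by case: leg => -[]; lia.
  have u'_gt0 : 0 < u' by case: leg' => -[]; lia.
  have nL : n <= (u + u').+1.
    by case: leg => -[? ?]; case: leg' => -[? ?]; lia.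
  have g_leg i : i < u -> g (u - i.+1) = o + i.
    by move=> iu; rewrite /g /leg_path; split_ifs; lia.
  have gu : g u = 0 by rewrite /g /leg_path ltnn eqxx.
  have gu1 : g u.+1 = o' by rewrite /g /leg_path; split_ifs; lia.
  split.
    exists g, (u + u').+1, u.-1; split=> //; first by lia.
    rewrite !prednK // (_ : u.-1 = u - 1) ?g_leg ?gu ?gu1 //; last by lia.
    by rewrite addn0 (par_root _ _ leg) (par_root _ _ leg'); left; split; [right | left].
  move=> i iu; exists g, (u + u').+1, (u - i.+2); split=> //; first by lia.
  have -> : g (u - i.+2) = (o + i).+1 by rewrite -addnS -g_leg.
  have -> : g (u - i.+2).+1 = o + i.
    by rewrite -g_leg; [congr g|]; lia.
  rewrite (par_leg _ _ _ leg iu).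
  right; split; first by right.
  case: i iu => [|i] iu.
    rewrite (_ : (u - 2).+2 = u); last by lia.
    by rewrite addn0 gu (par_root _ _ leg); right.
  have -> : g (u - i.+3).+2 = o + i.
    by rewrite -g_leg; [congr g|]; lia.
  rewrite addnS (par_leg _ _ _ leg); last by lia.
  by right.
(* Edges are named by their outer ends: first the three at the centre, then the rest leg by leg. *)
pose Q (i : nat) : nat :=
  if i == 0 then 1 else if i == 1 then k.+1 else if i == 2 then (2 * k).+1 else
  if i < 3 + k.-1 then i - 1 else if i < 3 + 2 * k.-1 then i else i.+1.
have Q3 i : i < k.-1 -> Q (3 + i) = (1 + i).+1.
  by move=> ik; rewrite /Q; split_ifs; lia.
have Q4 i : i < k.-1 -> Q (3 + k.-1 + i) = (k.+1 + i).+1.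
  by move=> ik; rewrite /Q; split_ifs; lia.
have Q5 i : Q (3 + 2 * k.-1 + i) = ((2 * k).+1 + i).+1.
  by rewrite /Q; split_ifs; lia.
have QP i : i < 3 + 2 * k.-1 + m.-1 -> 0 < Q i < (2 * k + m).+1.
  by move=> ?; rewrite /Q; split_ifs; lia.
have Q_inj i j : i < 3 + 2 * k.-1 + m.-1 -> j < 3 + 2 * k.-1 + m.-1 -> Q i = Q j -> i = j.
  by move=> ? ?; rewrite /Q; split_ifs; lia.
have [J12 J1] := joined _ _ _ _ leg1 leg2 ltac:(lia).
have [J23 J2] := joined _ _ _ _ leg2 leg3 ltac:(lia).
have [J31 J3] := joined _ _ _ _ leg3 leg1 ltac:(lia).
apply: (@embeds_HL n _ _ _ _ (fun i => par (Q i)) Q _ n_gt2 _ _ _ _ emb); first by lia.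
- move=> i iM; have Qi := QP i iM; split; [|lia|exact: spider_par].
  by have := par_lt (Q i); lia.
- move=> i j iM jM e; have Qi := QP i iM; have Qj := QP j jM.
  have := par_lt (Q i); have := par_lt (Q j).
  by case: e => -[e1 e2]; [move=> *; apply: Q_inj | lia].
move=> i j iM jM W; case: W iM jM => {i j}.
- by move=> [|[|i]] i3 _ _ //.
- by move=> _ _; apply: J31.
- move=> x o u [] [-> -> ->] u_gt0 _ _.
  + by have := J1 0 ltac:(lia); rewrite addn0 -[3]addn0 Q3 ?addn0.
  + by have := J2 0 ltac:(lia); rewrite addn0 -[3 + k.-1]addn0 Q4 ?addn0.
  + by have := J3 0 ltac:(lia); rewrite addn0 -[3 + 2 * k.-1]addn0 Q5 ?addn0.
- move=> x o u i [] [_ -> ->] iu _ _.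
  + by have := J1 i.+1 ltac:(lia); rewrite -[(3 + i).+1]addnS !Q3 //; lia.
  + by have := J2 i.+1 ltac:(lia); rewrite -[(3 + k.-1 + i).+1]addnS !Q4 ?addnS //; lia.
  + by have := J3 i.+1 ltac:(lia); rewrite -[(3 + 2 * k.-1 + i).+1]addnS !Q5 ?addnS.
- by [].
Qed.

(** * Assembling the stages *)

(** An empty third tail may be rooted anywhere, in particular at [N], where the step for two tails
    expects it. *)
Lemma wheel_third_root_irrel (ch : bool) (N p q q' t x y : nat) :
  wheel ch N p q t 0 x y -> wheel ch N p q' t 0 x y.
Proof.
case=> [i iN||i o u tl u_gt0|i o u j tl ju|ch_true].
- exact: WheelCycle.
- exact: WheelClose.
- case: tl => -[iE oE uE]; [| |lia].
    by apply: (@WheelRoot _ _ _ _ _ _ _ _ u) => //; constructor 1.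
  by apply: (@WheelRoot _ _ _ _ _ _ _ _ u) => //; constructor 2.
- case: tl => -[iE oE uE]; [| |lia].
    by apply: (@WheelTail _ _ _ _ _ _ i _ u) => //; constructor 1.
  by apply: (@WheelTail _ _ _ _ _ _ i _ u) => //; constructor 2.
- exact: WheelChord.
Qed.

Theorem theorem2p5 (n k : nat) (n_ge4 : 4 <= n) (n_le_2k : n <= 2 * k)
    (k1_lt_n : k + 1 < n) :
  diverges_by_order (path_graph n) (CL k k (n - k - 1)).
Proof.
set m := n - k - 1; set G := CL k k m; set H := path_graph n.
have nE : n = k + m + 1 by lia.
(* The arc bounds at stage [r] read [k + m + 1] and [2 * k + 1], both at least [n]. At [r = m] the
   third tail is used up. *)
have three_tails r : 0 < r <= m ->
    embeds (3 * r + 2 * (k - r) + (m - r))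
      (wheel false (3 * r) r (2 * r) (k - r) (m - r)) (HL_iter H r G).
  elim: r => [//|r IHr] rm; have [->|r_gt0] := posnP r.
    have -> : k - 1 = k.-1 by lia.
    have -> : m - 1 = m.-1 by lia.
    by apply: spider_HL (embeds_CL k m); lia.
  have -> : k - r.+1 = (k - r).-1 by lia.
  have -> : m - r.+1 = (m - r).-1 by lia.
  by apply: wheel_HL_three_tails (IHr _); lia.
(* A tail and the cycle have [k + 2 * m + i] vertices, at least [n] since [m] is positive. *)
have two_tails i : i <= k - m ->
    embeds (3 * m + 2 * i + 2 * (k - m - i))
      (wheel (0 < i) (3 * m + 2 * i) (m + i) 0 (k - m - i) 0) (HL_iter H (m + i) G).
  elim: i => [|i IHi] ik.
    have := three_tails m ltac:(lia); rewrite subnn muln0 !addn0 subn0.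
    by apply: embeds_sub => // x y _ _; apply: wheel_third_root_irrel.
  rewrite addnS.
  have -> : k - m - i.+1 = (k - m - i).-1 by lia.
  have -> : 3 * m + 2 * i.+1 = (3 * m + 2 * i).+2 by lia.
  apply: embeds_sub (leqnn _) _ (@wheel_HL_two_tails n (3 * m + 2 * i) (m + i) (k - m - i)
    _ _ _ _ _ _ _ _); try lia.
    by move=> x y _ _; apply: wheel_third_root_irrel.
  apply: embeds_sub (leqnn _) _ (IHi (ltnW ik)) => x y _ _ W.
  by case: (0 < i); [apply: wheel_chordS|]; apply: wheel_third_root_irrel W.
pose N := m + 2 * k.
have growing i : embeds (N + i) (wheel true (N + i) 0 0 0 0) (HL_iter H (k + i) G).
  elim: i => [|i IHi].
    (* From [n <= 2 * k] follows [m < k], so at least one step with two tails occurs and leaves a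
       chord. *)
    have km_gt0 : 0 < k - m by lia.
    have := two_tails (k - m) (leqnn _); rewrite subnn muln0 km_gt0 !addn0.
    have -> : m + (k - m) = k by lia.
    have -> : 3 * m + 2 * (k - m) = N by rewrite /N; lia.
    apply: embeds_sub => // x y _ _.
    case=> [a aN||a o u [] [_ _ ->]|a o u j [] [_ _ ->]|_] //.
    - exact: WheelCycle.
    - exact: WheelClose.
    - exact: WheelChord.
  by rewrite !addnS; apply: chorded_cycle_HL IHi; rewrite /N; lia.
move=> M _; exists (k + M).
by apply: leq_trans (embeds_card _ _ _ (growing M)); lia.
Qed.
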